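(* Let $m$ be the uniform distribution on $(0,1)$ and let $c\in\mathbb{R}$. Subject to the constraint that its marginal distribution is equal to $cm$, the mixing measure $\lambda$ for $m$ in the representation $$ \mathrm{cov}_m(u,v)=\int_0^1\int_0^1 u'(x)\,v'(y)\,d\lambda(x,y)\qquad(u,v\ \text{smooth and } 1\text{-periodic}) $$ is unique and has density $$ \frac{d\lambda(x,y)}{dx\,dy}=D(|x-y|)+\Big(c-\frac1{24}\Big),\quad x,y\in(0,1), $$ where $$ D(h)=\frac18\,\big[\,1-4h(1-h)\,\big],\quad 0\le h\le 1. $$
   Context: A mixing measure for a probability measure $\mu$ on $[0,1)$ is a (finite) signed Borel measure $\lambda$ on $[0,1)\times[0,1)$, symmetric about the diagonal $x=y$, such that $\mathrm{cov}_\mu(u,v)=\int_0^1\int_0^1 u'(x)v'(y)\,d\lambda(x,y)$ for all $1$-periodic smooth ($C^1$) functions $u,v$ on $\mathbb{R}$, where $\mathrm{cov}_\mu(u,v)=\int uv\,d\mu-\int u\,d\mu\int v\,d\mu$. The marginal of a symmetric signed measure $\lambda$ is $A\mapsto\lambda(A\times[0,1))$. *)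

(* Defs.v *)
From HB Require Import structures.
From mathcomp Require Import all_boot all_order all_algebra.
From mathcomp Require Import all_classical all_reals all_analysis.

Set Implicit Arguments.
Unset Strict Implicit.
Unset Printing Implicit Defensive.

Import Order.TTheory GRing.Theory Num.Theory.
Import numFieldNormedType.Exports.

Local Open Scope classical_set_scope.
Local Open Scope ring_scope.

(* Integral of a real function against a signed measure: integral against the
   positive part minus integral against the negative part of the Jordan
   decomposition (it does not depend on the Hahn decomposition chosen). *)
Definition charge_integral (d : measure_display) (T : measurableType d)
    (R : realType) (nu : {charge set T -> \bar R}) (D : set T) (f : T -> R) : R :=
  let nuP := cid (Hahn_decomposition nu) in
  let nuPN := cid (projT2 nuP) in
  let PN := projT2 nuPN in
  \int[jordan_pos PN]_(x in D) f x - \int[jordan_neg PN]_(x in D) f x.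

(* Product Borel sigma-algebra on R x R. *)
Notation plane R := (measurableTypeR R * measurableTypeR R)%type.

Definition periodic_C1 (R : realType) (u : R -> R) : Prop :=
  [/\ periodic u 1, (forall x : R, derivable u x 1) & continuous (derive1 u)].

(* [0,1) and [0,1) x [0,1) are not types here: measures on them are encoded as
   measures on R and on R * R carried by these sets. *)
Definition cov01 (R : realType) (mu : probability (measurableTypeR R) R)
    (u v : R -> R) : R :=
  \int[mu]_(x in `[0, 1[) (u x * v x)
  - \int[mu]_(x in `[0, 1[) u x * \int[mu]_(x in `[0, 1[) v x.

Section signed_measures_on_the_square.
Context (R : realType).
Implicit Type lam : {charge set (plane R) -> \bar R}.

Definition square01 : set (plane R) := `[0, 1[%classic `*` `[0, 1[%classic.

Definition carried_by_square lam : Prop :=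
  forall A : set (plane R), measurable A -> lam A = lam (A `&` square01).

Definition symmetric_charge lam : Prop :=
  forall A : set (plane R), measurable A -> lam [set z | A (z.2, z.1)] = lam A.

Definition mixing_measure (mu : probability (measurableTypeR R) R) lam : Prop :=
  [/\ carried_by_square lam, symmetric_charge lam &
    forall u v : R -> R, periodic_C1 u -> periodic_C1 v ->
      cov01 mu u v =
        charge_integral lam square01 (fun z => derive1 u z.1 * derive1 v z.2)].

Definition marginal lam (A : set (measurableTypeR R)) : \bar R :=
  lam (A `*` `[0, 1[%classic).

Definition open_square01 : set (plane R) := `]0, 1[%classic `*` `]0, 1[%classic.

Definition has_density lam (f : plane R -> R) : Prop :=
  let leb2 := (lebesgue_measure \x lebesgue_measure)%E in
  leb2.-integrable open_square01 (EFin \o f) /\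
  forall A : set (plane R), measurable A ->
    (lam A = \int[leb2]_(z in A `&` open_square01) (f z)%:E)%E.

End signed_measures_on_the_square.

Definition Dfun (R : realType) (h : R) : R := 8^-1 * (1 - 4 * h * (1 - h)).

(* The library law has its density on [0,1]; the endpoints are null sets. *)
Definition uniform01 (R : realType) : probability (measurableTypeR R) R :=
  uniform_prob (@ltr01 R).

(* Main.v *)
Require Import Defs.
From HB Require Import structures.
From mathcomp Require Import all_boot all_order all_algebra.
From mathcomp Require Import all_classical all_reals all_analysis.
From mathcomp Require Import measurable_realfun ring lra.

Set Implicit Arguments.
Unset Strict Implicit.
Unset Printing Implicit Defensive.

Import Order.TTheory GRing.Theory Num.Theory.
Import numFieldNormedType.Exports.

Local Open Scope classical_set_scope.
Local Open Scope ring_scope.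

(** The function D is, up to an additive constant, the Green function of minus
    the second derivative on the circle: on (0, 1) its second derivative is 1,
    and the jump of its first derivative at the diagonal is -1.  Integrating
    u'(x) v'(y) D(|x - y|) by parts twice therefore turns the jump into the
    integral of u v and the constant 1 into minus the product of the two
    means: together, the covariance.  Adding a constant to the density changes
    nothing there, because u' and v' have mean zero, but it shifts the marginal;
    as D has mean 1/24, the constant c - 1/24 is the one that gives the marginal
    c times the uniform law.  Both computations are instances of one formula for
    the integral of v'(y) against the density in y alone
    ([Rintegral_mixing_kernel]): v periodic for the covariance
    ([double_integral_mixing_kernel]), v the identity for the marginal.

    For uniqueness, two mixing measures of the same law give the same integral
    to f(x) g(y) whenever f and g are continuous, periodic and of mean zero,
    since these are exactly the derivatives of the admissible u and v
    ([mean_zero_periodic_primitive]).  A continuous periodic function is a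
    constant plus a function of mean zero, and the integrals of functions of a
    single coordinate are determined by the marginal and by symmetry, so the
    mean-zero restriction can be dropped ([mixing_measure_unique]).  Indicators
    of rays cut down to [0, 1) are bounded limits of continuous periodic
    functions ([ray_approx]), so the two signed measures agree on products of
    rays, which form a pi-system generating the Borel sets of the plane
    ([eq_charge_of_tensors]).

    The integral against a signed measure is defined through a chosen Hahn
    decomposition.  Its properties are derived from [charge_integral_jordan], which
    presents the signed measure as a difference of two finite measures; for a
    signed measure with a density, the Radon-Nikodym theorem applied to these
    two measures gives the expected integral ([charge_integral_induced]). *)

(** * Primitives of continuous functions on the line *)

Section calculus.
Context {R : realType}.
Local Notation mu := (@lebesgue_measure R).
Implicit Types (f F G : R -> R) (a b x : R).

Lemma continuous_integrable_segment f a b :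
  continuous f -> mu.-integrable `[a, b] (EFin \o f).
Proof.
move=> cf; apply: continuous_compact_integrable; first exact: segment_compact.
exact: continuous_subspaceT.
Qed.

Lemma is_derive1_continuous F f :
  (forall x, is_derive x 1 F (f x)) -> continuous F.
Proof.
move=> dF x; apply/differentiable_continuous/derivable1_diffP.
by have [] := dF x.
Qed.

Lemma Rintegral_antiderivative F f a b : a <= b ->
  (forall x, is_derive x 1 F (f x)) -> continuous f ->
  \int[mu]_(x in `[a, b]) f x = F b - F a.
Proof.
move=> ab dF cf; move: ab; rewrite le_eqVlt => /predU1P[<-|ab].
  by rewrite set_itv1 Rintegral_set1 subrr.
rewrite /Rintegral (@continuous_FTC2 _ f F)//.
- exact: continuous_subspaceT.
- have cF := is_derive1_continuous dF.
  split; first by move=> x _; have [] := dF x.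
    exact: cvg_at_right_filter (cF a).
  exact: cvg_at_left_filter (cF b).
- by move=> x _; rewrite derive1E; have [] := dF x.
Qed.

(** The functions to be integrated live on the circle and are shifted by
    periodicity, so a primitive is needed on the whole line, on both sides of
    the base point 0. *)
Lemma continuous_antiderivative f : continuous f ->
  exists F, forall x, is_derive x 1 F (f x).
Proof.
move=> cf.
pose F x := if 0 <= x then \int[mu]_(t in `[0, x]) f t
            else - \int[mu]_(t in `[x, 0]) f t.
have FE a x : a < 0 -> a < x ->
    F x = \int[mu]_(t in `[a, x]) f t - \int[mu]_(t in `[a, 0]) f t.
  move=> a0 ax; rewrite /F; case: ifPn => [x0|].
    rewrite Rintegral_itvB ?bnd_simp ?(ltW a0)//; last first.
      exact: continuous_integrable_segment.
    rewrite Rintegral_itv_obnd_cbnd//.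
    apply: integrableS (continuous_integrable_segment 0 x cf) => //.
    exact: subset_itv_oc_cc.
  rewrite -ltNge => x0; rewrite -opprB; congr (- _).
  rewrite Rintegral_itvB ?bnd_simp ?(ltW x0) ?(ltW ax)//; last first.
    exact: continuous_integrable_segment.
  rewrite Rintegral_itv_obnd_cbnd//.
  apply: integrableS (continuous_integrable_segment x 0 cf) => //.
  exact: subset_itv_oc_cc.
exists F => x.
(* With a base point a to the left of both x and 0, F is near x the integral
   from a up to a constant, to which the one-sided fundamental theorem applies. *)
pose a := Num.min x 0 - 1.
have a0 : a < 0 by rewrite /a; have := ge_min 0 x 0; rewrite lexx orbT; lra.
have ax : a < x by rewrite /a; have := ge_min x x 0; rewrite lexx; lra.
have [dG G'] := @continuous_FTC1_closed _ f a x (x + 1) (ltac:(lra))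
  (continuous_integrable_segment _ _ cf) ax (cf x).
set G := (fun y => _) in dG G'.
have dGx : is_derive x 1 G (f x).
  by apply: DeriveDef; [exact: dG|rewrite -derive1E; exact: G'].
have dG0 : is_derive x 1 (G - cst (G 0)) (f x).
  by apply: is_derive_eq; rewrite subr0.
apply: near_eq_is_derive dG0.
by near=> y; rewrite (FE a)//; near: y; exact: lt_nbhsr.
Unshelve. all: by end_near. Qed.

End calculus.

(** * Integrating against the mixing density in one variable *)

Section green_kernel.
Context {R : realType}.
Local Notation mu := (@lebesgue_measure R).
Implicit Types (f g u v V W : R -> R) (c x y : R).

Definition mixing_kernel c x y : R := Dfun `|x - y| + (c - 24^-1).

Lemma continuous_mixing_kernel c x : continuous (mixing_kernel c x).
Proof.
move=> y; rewrite /mixing_kernel /Dfun.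
have ch : {for y, continuous (fun y => `|x - y|)}.
  apply: (@continuous_comp _ _ _ (fun y => x - y) Num.norm);
    last exact: norm_continuous.
  by apply: cvgB; [exact: cvg_cst|exact: cvg_id].
apply: cvgD; last exact: cvg_cst.
apply: cvgM; first exact: cvg_cst.
apply: cvgB; first exact: cvg_cst.
apply: cvgM; first by apply: cvgM; [exact: cvg_cst|exact: ch].
by apply: cvgB; [exact: cvg_cst|exact: ch].
Qed.

(** Two integrations by parts in y, on each side of x.  The boundary terms at
    y = x cancel except for -V x, which comes from the jump of the derivative
    of the density across the diagonal.  Nothing is assumed periodic: the terms
    in v 1 - v 0 and V 1 - V 0 are what the marginal computation needs. *)
Lemma Rintegral_mixing_kernel c g v V W x : continuous g ->
    (forall y, is_derive y 1 v (g y)) -> (forall y, is_derive y 1 V (v y)) ->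
    (forall y, is_derive y 1 W (V y)) -> 0 <= x <= 1 ->
  \int[mu]_(y in `[0, 1]) (g y * mixing_kernel c x y) =
  - V x + (v 1 - v 0) * ((x * x - x) / 2 + (8^-1 + c - 24^-1))
  - (V 1 - V 0) * (2^-1 - x) + (W 1 - W 0).
Proof.
move=> cg dv dV dW /andP[x0 x1].
have cgK : continuous (fun y => g y * mixing_kernel c x y).
  by move=> y; apply: cvgM; [exact: cg|exact: continuous_mixing_kernel].
have int a b := @continuous_integrable_segment R _ a b cgK.
have cv := is_derive1_continuous dv.
have -> : \int[mu]_(y in `[0, 1]) (g y * mixing_kernel c x y) =
    \int[mu]_(y in `[0, x]) (g y * mixing_kernel c x y) +
    \int[mu]_(y in `[x, 1]) (g y * mixing_kernel c x y).
  rewrite -[X in _ + X]Rintegral_itv_obnd_cbnd; last first.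
    by apply: integrableS (int x 1) => //; exact: subset_itv_oc_cc.
  by rewrite -(@Rintegral_itvB _ _ (BLeft 0) (BRight 1)) ?bnd_simp// addrC subrK.
(* Dfun |x - y| is e^2/2 + s e/2 + 1/8 with e = y - x, where s = 1 to the left
   of x and s = -1 to its right; Phi s is then a primitive of g times it. *)
pose e : R -> R := id - cst x.
pose d := 8^-1 + c - 24^-1.
pose Phi s : R -> R :=
  v * (2^-1 \*: (e * e) + (s * 2^-1) \*: e + cst d) - V * (e + cst (s * 2^-1)) + W.
pose phi s y := g y * (2^-1 * (y - x) ^+ 2 + s * 2^-1 * (y - x) + d).
have de y : is_derive y 1 e 1 by apply: is_derive_eq; rewrite subr0.
have dPhi s y : is_derive y 1 (Phi s) (phi s y).
  rewrite /Phi; apply: is_derive_eq; rewrite /phi/= /e /=.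
  rewrite !fctE /=.
  rewrite /GRing.scale /=.
  by field.
have cphi s : continuous (phi s).
  move=> y; apply: cvgM; first exact: cg.
  apply: cvgD; last exact: cvg_cst.
  apply: cvgD; apply: cvgM; try exact: cvg_cst.
    by apply: (@cvgM _ _ _ _ (fun y => y - x) (fun y => y - x));
       apply: cvgB; [exact: cvg_id|exact: cvg_cst|exact: cvg_id|exact: cvg_cst].
  by apply: cvgB; [exact: cvg_id|exact: cvg_cst].
have -> : \int[mu]_(y in `[0, x]) (g y * mixing_kernel c x y) =
          \int[mu]_(y in `[0, x]) phi 1 y.
  apply: eq_Rintegral => y /[!inE] /=; rewrite in_itv/= => /andP[_ yx].
  rewrite /phi /mixing_kernel /Dfun /d ger0_norm ?subr_ge0//.
  by field.
have -> : \int[mu]_(y in `[x, 1]) (g y * mixing_kernel c x y) =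
          \int[mu]_(y in `[x, 1]) phi (-1) y.
  apply: eq_Rintegral => y /[!inE] /=; rewrite in_itv/= => /andP[xy _].
  rewrite /phi /mixing_kernel /Dfun /d ler0_norm ?subr_le0//.
  by field.
rewrite (Rintegral_antiderivative x0 (dPhi 1))//.
rewrite (Rintegral_antiderivative x1 (dPhi (-1)))//.
rewrite /Phi /= !fctE /= /e /= !fctE /GRing.scale /= -/d.
by field.
Qed.

(** The derivative of the identity is 1, so this is the previous formula for
    v y = y, V y = y^2/2 and W y = y^3/6. *)
Lemma Rintegral_mixing_kernel1 c x : 0 <= x <= 1 ->
  \int[mu]_(y in `[0, 1]) mixing_kernel c x y = c.
Proof.
move=> x01.
pose V : R -> R := 2^-1 \*: (id * id).
pose W : R -> R := 6^-1 \*: (id * (id * id)).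
have VE y : V y = 2^-1 * (y * y) by [].
have WE y : W y = 6^-1 * (y * (y * y)) by [].
have dV y : is_derive y 1 V y.
  by apply: is_derive_eq; rewrite /GRing.scale /=; field.
have dW y : is_derive y 1 W (V y).
  by apply: is_derive_eq; rewrite VE !fctE /GRing.scale /=; field.
transitivity (\int[mu]_(y in `[0, 1]) (cst 1 y * mixing_kernel c x y)).
  by apply: eq_Rintegral => y _; rewrite mul1r.
rewrite (@Rintegral_mixing_kernel c (cst 1) id V W)//; last exact: cst_continuous.
by rewrite !VE !WE; field.
Qed.

(** By [Rintegral_mixing_kernel] the inner integral is f x * J x with
    J' = M - v and M the mean of v.  Since J 1 = J 0 and u 1 = u 0, a last
    integration by parts leaves the integral of u * (v - M). *)
Lemma double_integral_mixing_kernel c f g u v : continuous f -> continuous g ->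
    (forall x, is_derive x 1 u (f x)) -> (forall x, is_derive x 1 v (g x)) ->
    u 0 = u 1 -> v 0 = v 1 ->
  \int[mu]_(x in `[0, 1])
     \int[mu]_(y in `[0, 1]) (f x * g y * mixing_kernel c x y) =
  \int[mu]_(x in `[0, 1]) (u x * v x) -
  \int[mu]_(x in `[0, 1]) u x * \int[mu]_(x in `[0, 1]) v x.
Proof.
move=> cf cg du dv u01 v01.
have cu := is_derive1_continuous du; have cv := is_derive1_continuous dv.
have [V dV] := continuous_antiderivative cv.
have cV := is_derive1_continuous dV.
have [W dW] := continuous_antiderivative cV.
pose M := V 1 - V 0.
pose J : R -> R := - V - M \*: (cst 2^-1 - id) + cst (W 1 - W 0).
have JE x : J x = - V x - M * (2^-1 - x) + (W 1 - W 0) by [].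
have dJ x : is_derive x 1 J (M - v x).
  by apply: is_derive_eq; rewrite /GRing.scale /=; ring.
have cJ := is_derive1_continuous dJ.
have VM : \int[mu]_(x in `[0, 1]) v x = M.
  by rewrite (Rintegral_antiderivative ler01 dV).
have inner x : x \in `[0, 1]%classic ->
    \int[mu]_(y in `[0, 1]) (f x * g y * mixing_kernel c x y) = f x * J x.
  rewrite inE/= in_itv/= => x01.
  under eq_Rintegral do rewrite -mulrA.
  rewrite RintegralZl//; last first.
    apply: continuous_integrable_segment => y.
    by apply: cvgM; [exact: cg|exact: continuous_mixing_kernel].
  rewrite (Rintegral_mixing_kernel c cg dv dV dW x01) v01 subrr mul0r addr0.
  by rewrite JE.
under eq_Rintegral => x xD do rewrite inner//.
rewrite VM.
have duJ x : is_derive x 1 (u * J) (f x * J x + u x * (M - v x)).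
  by apply: is_derive_eq; rewrite /GRing.scale /=; ring.
have cfJ : continuous (fun x => f x * J x).
  by move=> x; apply: cvgM; [exact: cf|exact: cJ].
have cuv : continuous (fun x => u x * v x).
  by move=> x; apply: cvgM; [exact: cu|exact: cv].
have cMu : continuous (fun x => M * u x).
  by move=> x; apply: cvgM; [exact: cvg_cst|exact: cu].
have cuM : continuous (fun x => u x * (M - v x)).
  move=> x; apply: cvgM; first exact: cu.
  by apply: cvgB; [exact: cvg_cst|exact: cv].
have int h := @continuous_integrable_segment R h 0 1.
have : \int[mu]_(x in `[0, 1]) (f x * J x + u x * (M - v x)) = 0.
  rewrite (Rintegral_antiderivative ler01 duJ); last first.
    by move=> x; apply: cvgD; [exact: cfJ|exact: cuM].
  by rewrite !fctE !JE u01 /M; field.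
rewrite RintegralD//; [|exact: int..].
have -> : \int[mu]_(x in `[0, 1]) (u x * (M - v x)) =
    \int[mu]_(x in `[0, 1]) (M * u x) - \int[mu]_(x in `[0, 1]) (u x * v x).
  rewrite -RintegralB//; [|exact: int..].
  by apply: eq_Rintegral => x _; ring.
rewrite RintegralZl//; last exact: int.
lra.
Qed.

End green_kernel.

(** * Integrals against signed measures *)

(** Subtraction-free form of the equality of two signed measures, which can be
    stated between measures. *)
Lemma fin_num_subr_eq (R : realDomainType) (p q p' q' : \bar R) :
    p \is a fin_num -> q \is a fin_num -> p' \is a fin_num -> q' \is a fin_num ->
  (p - q = p' - q' <-> p + q' = p' + q)%E.
Proof.
case: p q p' q' => [p||] [q||] [p'||] [q'||] // _ _ _ _.
by rewrite -!EFinB -!EFinD; split => -[?]; congr EFin; lra.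
Qed.

Definition bounded_measurable d (T : measurableType d) (R : realType)
    (D : set T) (f : T -> R) :=
  measurable_fun D f /\ exists M, forall x, D x -> `|f x| <= M.

Section charge_integral_theory.
Context d (T : measurableType d) (R : realType).
Implicit Types (nu : {charge set T -> \bar R}) (D A : set T) (f g : T -> R).

Lemma bounded_measurable_integrable (mu : {measure set T -> \bar R}) D f :
  measurable D -> (mu D < +oo)%E -> bounded_measurable D f ->
  mu.-integrable D (EFin \o f).
Proof.
move=> mD muD [mf [M fM]]; apply: measurable_bounded_integrable => //.
exists M; split; first exact: num_real.
by move=> x Mx y Dy; exact: le_trans (fM _ Dy) (ltW Mx).
Qed.

Lemma finite_measure_integrable (mu : {finite_measure set T -> \bar R}) D f :
  measurable D -> bounded_measurable D f -> mu.-integrable D (EFin \o f).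
Proof.
move=> mD; apply: bounded_measurable_integrable => //.
by rewrite -ge0_fin_numE ?fin_num_measure.
Qed.

(** This hides the Hahn decomposition chosen in the definition of
    [charge_integral].  Domination is kept because the Radon-Nikodym derivatives
    of the two parts are needed when [nu] has a density. *)
Lemma charge_integral_jordan nu : exists P N : {finite_measure set T -> \bar R},
  [/\ forall A, measurable A -> nu A = (P A - N A)%E,
      forall D f, charge_integral nu D f =
                  \int[P]_(x in D) f x - \int[N]_(x in D) f x
    & forall mu : {measure set T -> \bar R}, nu `<< mu -> P `<< mu /\ N `<< mu].
Proof.
pose nuP := cid (Hahn_decomposition nu).
pose nuPN := cid (projT2 nuP).
exists (jordan_pos (projT2 nuPN)), (jordan_neg (projT2 nuPN)); split => //.
- by move=> A mA; rewrite (jordan_decomp (projT2 nuPN) mA)/= /cadd/= cscaleN1.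
- move=> mu numu; split; first exact: jordan_pos_dominates.
  exact: jordan_neg_dominates.
Qed.

Lemma eq_charge_integral nu D f g : {in D, f =1 g} ->
  charge_integral nu D f = charge_integral nu D g.
Proof.
by move=> fg; rewrite /charge_integral; congr (_ - _); exact: eq_Rintegral.
Qed.

Lemma charge_integralD nu D f g : measurable D ->
    bounded_measurable D f -> bounded_measurable D g ->
  charge_integral nu D (fun x => f x + g x) =
  charge_integral nu D f + charge_integral nu D g.
Proof.
move=> mD bf bg; have [P [N [_ iE _]]] := charge_integral_jordan nu.
rewrite !iE !RintegralD//; try exact: finite_measure_integrable.
by rewrite opprD addrACA.
Qed.

Lemma charge_integralZl nu D f r : measurable D -> bounded_measurable D f ->
  charge_integral nu D (fun x => r * f x) = r * charge_integral nu D f.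
Proof.
move=> mD bf; have [P [N [_ iE _]]] := charge_integral_jordan nu.
rewrite !iE !RintegralZl//; try exact: finite_measure_integrable.
by rewrite mulrBr.
Qed.

Lemma charge_integral_indic nu D A : measurable D -> measurable A ->
  charge_integral nu D \1_A = fine (nu (A `&` D)).
Proof.
move=> mD mA; have [P [N [nuE iE _]]] := charge_integral_jordan nu.
have mAD : measurable (A `&` D) by exact: measurableI.
rewrite iE nuE// fineB ?fin_num_measure//.
by rewrite /Rintegral !integral_indic.
Qed.

Lemma charge_integral_cvg nu D (f_ : (T -> R)^nat) f M : measurable D ->
    (forall n, measurable_fun D (f_ n)) -> measurable_fun D f ->
    (forall n x, D x -> `|f_ n x| <= M) ->
    (forall x, D x -> f_ ^~ x @ \oo --> f x) ->
  charge_integral nu D (f_ n) @[n --> \oo] --> charge_integral nu D f.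
Proof.
move=> mD mf_ mf f_M f_f; have [P [N [_ iE _]]] := charge_integral_jordan nu.
under eq_fun do rewrite iE.
rewrite iE.
suff cvgI (m : {finite_measure set T -> \bar R}) :
    \int[m]_(x in D) (f_ n x) @[n --> \oo] --> \int[m]_(x in D) f x.
  by apply: cvgB; exact: cvgI.
have := @dominated_convergence _ _ _ m D mD (fun n => EFin \o f_ n) (EFin \o f)
  (EFin \o cst M).
case.
- by move=> n; exact/measurable_EFinP.
- exact/measurable_EFinP.
- by apply: aeW => x Dx; apply: cvg_EFin; [exact: nearW|exact: f_f].
- exact: finite_measure_integrable_cst.
- by apply: aeW => x n Dx /=; rewrite lee_fin f_M.
move=> intf _ cvgI.
apply: fine_cvg; rewrite fineK//.
exact: integrable_fin_num.
Qed.

(** Uniqueness of finite measures on a pi-system applies to P1 + N2 and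
    P2 + N1, where the decompositions nu1 = P1 - N1 and nu2 = P2 - N2 have been
    cleared of minus signs. *)
Lemma eq_charge nu1 nu2 (G : set (set T)) :
    measurable = <<s G >> -> setI_closed G -> G setT ->
    (forall A, G A -> nu1 A = nu2 A) ->
  forall A, measurable A -> nu1 A = nu2 A.
Proof.
move=> mG IG GT G12 A mA.
have [P1 [N1 [nu1E _ _]]] := charge_integral_jordan nu1.
have [P2 [N2 [nu2E _ _]]] := charge_integral_jordan nu2.
have cross B : measurable B ->
    measure_add P1 N2 B = measure_add P2 N1 B <-> nu1 B = nu2 B.
  move=> mB; rewrite !measure_addE nu1E// nu2E//.
  by apply: iff_sym; apply: fin_num_subr_eq; exact: fin_num_measure.
apply/cross => //.
apply: (measure_unique G (fun=> setT)) => //.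
- by rewrite bigcup_const.
- move=> B GB; apply/cross; last exact: G12.
  by rewrite mG; exact: sub_sigma_algebra.
- move=> _; rewrite -[X in (X < _)%E]/(measure_add P1 N2 setT) measure_addE.
  by rewrite -ge0_fin_numE ?adde_ge0// fin_numD !fin_num_measure.
Qed.

(** The integral of h o phi depends only on the image of the signed measure under
    phi.  As in [eq_charge], minus signs are cleared first; the two resulting
    measures, restricted to D, have the same image under phi. *)
Lemma eq_charge_integral_comp d' (S : measurableType d') (phi : T -> S)
    nu1 nu2 D (h : S -> R) :
    measurable D -> measurable_fun setT phi -> bounded_measurable setT h ->
    (forall A : set S, measurable A ->
       nu1 (phi @^-1` A `&` D) = nu2 (phi @^-1` A `&` D)) ->
  charge_integral nu1 D (h \o phi) = charge_integral nu2 D (h \o phi).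
Proof.
move=> mD mphi bh nu12.
have [P1 [N1 [nu1E i1E _]]] := charge_integral_jordan nu1.
have [P2 [N2 [nu2E i2E _]]] := charge_integral_jordan nu2.
have bhphi : bounded_measurable D (h \o phi).
  case: bh => mh [M hM]; split; last by exists M => x _; exact: hM.
  by apply: measurable_funTS; exact: measurableT_comp.
have mhphi : measurable_fun setT (h \o phi).
  by apply: measurableT_comp => //; exact: bh.1.
have mh : measurable_fun setT (EFin \o h) by apply/measurable_EFinP; exact: bh.1.
have bhphiT : bounded_measurable setT (h \o phi).
  by split=> //; have [M hM] := bh.2; exists M => x _; exact: hM.
have int_restr (m : {measure set T -> \bar R}) : (m D < +oo)%E ->
    (mrestr m mD).-integrable setT (EFin \o (h \o phi)).
  by move=> mDoo; apply: bounded_measurable_integrable => //=; rewrite /mrestr setTI.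
have restrE (m : {measure set T -> \bar R}) : (m D < +oo)%E ->
    (\int[m]_(x in D) (h (phi x))%:E =
     \int[mrestr m mD]_(x in phi @^-1` setT) (h (phi x))%:E)%E.
  move=> mDoo; rewrite preimage_setT.
  rewrite (@negligible_integral _ _ _ (mrestr m mD) setT (~` D))//.
  - rewrite setTD setCK; apply: eq_measure_integral => A mA AD.
    by rewrite /= /mrestr setIidl.
  - exact: measurableC.
  - exact: int_restr.
  - by rewrite /= /mrestr setICl measure0.
have eq_comp (a b : {measure set T -> \bar R}) : (a D < +oo)%E -> (b D < +oo)%E ->
    (forall A : set S, measurable A ->
       a (phi @^-1` A `&` D) = b (phi @^-1` A `&` D)) ->
    (\int[a]_(x in D) (h (phi x))%:E = \int[b]_(x in D) (h (phi x))%:E)%E.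
  move=> aD bD ab; rewrite !restrE//.
  rewrite -!(integral_pushforward mphi mh)//;
    try by rewrite preimage_setT; exact: int_restr.
  by apply: eq_measure_integral => A mA _; exact: ab.
have int (m : {finite_measure set T -> \bar R}) := finite_measure_integrable m mD bhphi.
suff cross : \int[P1]_(x in D) (h \o phi) x + \int[N2]_(x in D) (h \o phi) x =
    \int[P2]_(x in D) (h \o phi) x + \int[N1]_(x in D) (h \o phi) x.
  by rewrite i1E i2E; lra.
rewrite /Rintegral -!fineD; try exact: (integrable_fin_num mD (int _)).
congr fine.
rewrite -!integral_measure_add//; try exact: int; try exact: measurable_int (int P1).
have fin (m n : {finite_measure set T -> \bar R}) : (measure_add m n D < +oo)%E.
  by rewrite measure_addE -ge0_fin_numE ?adde_ge0// fin_numD !fin_num_measure.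
apply: eq_comp; [exact: fin|exact: fin|move=> A mA].
have mB : measurable (phi @^-1` A `&` D).
  by apply: measurableI => //; rewrite -[X in measurable X]setTI; exact: mphi.
suff : measure_add P1 N2 (phi @^-1` A `&` D) =
       measure_add P2 N1 (phi @^-1` A `&` D) by [].
have := nu12 _ mA; rewrite nu1E// nu2E// !measure_addE.
by move/fin_num_subr_eq; apply; exact: fin_num_measure.
Qed.

(** The Radon-Nikodym derivatives p and q of the two Jordan parts satisfy
    p - q = f almost everywhere, because both sides have the same integral over
    every measurable set. *)
Lemma charge_integral_induced (mu : {sigma_finite_measure set T -> \bar R})
    (f : T -> \bar R) (intf : mu.-integrable setT f) D g :
  measurable D -> bounded_measurable D g ->
  charge_integral (induced_charge intf) D g =
  fine (\int[mu]_(x in D) ((g x)%:E * f x))%E.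
Proof.
move=> mD bg.
have [P [N [nuE iE dom]]] := charge_integral_jordan (induced_charge intf).
have nu_mu : induced_charge intf `<< mu.
  move=> A /= nullA B mB BA; apply: null_set_integral => //.
    by apply: measurable_funTS; exact: measurable_int intf.
  exact: nullA.
have [Pmu Nmu] := dom _ nu_mu.
have intP := finite_measure_integrable P mD bg.
have intN := finite_measure_integrable N mD bg.
rewrite iE /Rintegral.
rewrite -(Radon_Nikodym_change_of_variables Pmu mD intP).
rewrite -(Radon_Nikodym_change_of_variables Nmu mD intN).
set p := Radon_Nikodym _ mu; set q := Radon_Nikodym _ mu.
have ip : mu.-integrable setT p by exact: Radon_Nikodym_integrable.
have iq : mu.-integrable setT q by exact: Radon_Nikodym_integrable.
have pE A : measurable A -> P A = (\int[mu]_(x in A) p x)%E.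
  by move=> mA; rewrite -Radon_Nikodym_integral.
have qE A : measurable A -> N A = (\int[mu]_(x in A) q x)%E.
  by move=> mA; rewrite -Radon_Nikodym_integral.
have sub h : mu.-integrable setT h -> mu.-integrable D h.
  by move=> ih; exact: integrableS ih.
have bdg : [bounded g x | x in D].
  have [_ [M gM]] := bg; exists M; split; first exact: num_real.
  by move=> x Mx y Dy; exact: le_trans (gM _ Dy) (ltW Mx).
have ig h : mu.-integrable setT h -> mu.-integrable D (fun x => (g x)%:E * h x)%E.
  by move=> ih; apply: integrableMr => //; [exact: bg.1|exact: sub].
rewrite -fineB; [|exact: integrable_fin_num (ig _ _)..].
congr fine.
rewrite -integralB//; [|exact: ig..].
have pqf : ae_eq mu D f (p \- q)%E.
  apply: integral_ae_eq => //; first exact: sub.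
    by apply: measurable_int (sub _ (integrableB _ ip iq)).
  move=> A AD mA.
  rewrite integralB//; [|exact: integrableS ip|exact: integrableS iq].
  by rewrite -pE// -qE// -nuE.
apply: ae_eq_integral => //.
- by apply: measurable_int (integrableB _ (ig _ ip) (ig _ iq)).
- exact: measurable_int (ig _ intf).
- move: pqf; apply: filterS => x /[apply] ->.
  by rewrite muleBr// fin_num_adde_defr// Radon_Nikodym_fin_num.
Qed.
End charge_integral_theory.

(** * Rays and their approximation by continuous periodic functions *)

Section rays.
Context {R : realType}.

(** The whole line is added to the open rays so that the plane itself is a
    product of two rays, as [eq_charge] requires of its pi-system. *)
Definition rays : set (set (measurableTypeR R)) :=
  [set A | A = setT \/ exists a, A = `]a, +oo[%classic].

Lemma measurable_rays : measurable = <<s rays >>.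
Proof.
rewrite eqEsubset; split.
  have -> : @measurable _ (measurableTypeR R) = <<s @RGenOInfty.G R >>.
    exact: RGenOInfty.measurableE.
  apply: smallest_sub; first exact: smallest_sigma_algebra.
  by move=> A [a ->]; apply: sub_sigma_algebra; right; exists a.
apply: smallest_sub; first exact: sigma_algebra_measurable.
by move=> A [->|[a ->]] //; exact: measurable_itv.
Qed.

Lemma rays_setI : setI_closed rays.
Proof.
move=> A B [->|[a ->]] [->|[b ->]].
- by left; rewrite setTI.
- by right; exists b; rewrite setTI.
- by right; exists a; rewrite setIT.
- right; exists (Num.max a b); apply/seteqP; split => x /=; rewrite !in_itv/= !andbT.
    by case=> ax bx; rewrite gt_max ax.
  by rewrite gt_max => /andP[].
Qed.

Definition quadrants : set (set (plane R)) :=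
  [set A `*` B | A in rays & B in rays].

Lemma measurable_quadrants : measurable = <<s quadrants >>.
Proof.
rewrite eqEsubset; split; last first.
  apply: smallest_sub; first exact: sigma_algebra_measurable.
  move=> _ [A rA [B rB <-]]; apply: measurableX; rewrite measurable_rays;
    exact: sub_sigma_algebra.
rewrite measurable_prod_measurableType.
apply: smallest_sub; first exact: smallest_sigma_algebra.
pose Q := g_sigma_algebraType quadrants.
have mfst : measurable_fun setT (fst : Q -> measurableTypeR R).
  apply: (measurability _ measurable_rays) => _ [A rA <-].
  rewrite setTI; apply: sub_sigma_algebra; exists A => //; exists setT; first by left.
  by apply/seteqP; split => z //= -[].
have msnd : measurable_fun setT (snd : Q -> measurableTypeR R).
  apply: (measurability _ measurable_rays) => _ [A rA <-].
  rewrite setTI; apply: sub_sigma_algebra; exists setT; first by left.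
  by exists A => //; apply/seteqP; split => z //= -[].
move=> _ [A mA [B mB <-]].
have -> : A `*` B = (fst @^-1` A) `&` (snd @^-1` B) by [].
rewrite -[X in X `&` _]setTI -[X in _ `&` X]setTI.
exact: (@measurableI _ Q _ _ (mfst measurableT _ mA) (msnd measurableT _ mB)).
Qed.

Lemma quadrants_setI : setI_closed quadrants.
Proof.
move=> _ _ [A1 rA1 [A2 rA2 <-]] [B1 rB1 [B2 rB2 <-]].
exists (A1 `&` B1); first exact: rays_setI.
exists (A2 `&` B2); first exact: rays_setI.
by rewrite setXI.
Qed.

Lemma quadrantsT : quadrants setT.
Proof. by exists setT; [left|exists setT; [left|rewrite setXTT]]. Qed.

(** On [0, 1), with 0 <= a < 1, the product of sines is positive exactly on
    (a, 1): both factors change sign under x |-> x + 1, so it is a function on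
    the circle, vanishing at the ends 0 and a of the arc.  Scaling it by n and
    cutting it to [0, 1] gives continuous approximations of the indicator of
    the arc. *)
Definition arc_bump (a : R) (n : nat) : R -> R :=
  cst 1 \min (cst n%:R * (cst 0 \max (fun x => sin (pi * x) * sin (pi * (x - a))))).

Lemma continuous_sin_pi (a : R) : continuous (fun x : R => sin (pi * (x - a))).
Proof.
move=> x; apply: (@continuous_comp _ _ _ (fun x => pi * (x - a)) sin);
  last exact: continuous_sin.
by apply: cvgM; [exact: cvg_cst|apply: cvgB; [exact: cvg_id|exact: cvg_cst]].
Qed.

Lemma continuous_arc_bump a n : continuous (arc_bump a n).
Proof.
move=> x; apply: continuous_min; first exact: cvg_cst.
apply: continuousM; first exact: cvg_cst.
apply: continuous_max; first exact: cvg_cst.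
apply: (@continuousM _ _ (fun x => sin (pi * x))); last exact: continuous_sin_pi.
by have := @continuous_sin_pi 0 x; under eq_fun do rewrite subr0.
Qed.

Lemma periodic_arc_bump a n : periodic (arc_bump a n) 1.
Proof.
move=> x; rewrite /arc_bump/= !fctE/=; congr (Num.min _ (_ * Num.max _ _)).
rewrite mulrDr mulr1 sinDpi.
rewrite (_ : pi * (x + 1 - a) = pi * (x - a) + pi); last by ring.
by rewrite sinDpi mulrNN.
Qed.

Lemma arc_bump_le1 a n x : `|arc_bump a n x| <= 1.
Proof.
rewrite ger0_norm; first by rewrite /arc_bump/= ge_min lexx.
by rewrite /arc_bump/= le_min ler01/= mulr_ge0// le_max lexx.
Qed.

Lemma arc_bump_cvg (a x : R) : 0 <= a < 1 -> 0 <= x < 1 ->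
  arc_bump a n x @[n --> \oo] --> (\1_(`]a, +oo[%classic) x : R).
Proof.
move=> /andP[a0 a1] /andP[x0 x1]; rewrite indicE.
have pi0 : 0 < pi :> R := pi_gt0 R.
rewrite mem_setE in_itv/= andbT; case: ltP => [ax|xa] /=.
  have s0 : 0 < sin (pi * x) * sin (pi * (x - a)).
    apply: mulr_gt0; apply: sin_gt0_pi.
      by apply/andP; split; [apply: mulr_gt0 => //; lra|rewrite gtr_pMr].
    by apply/andP; split; [apply: mulr_gt0 => //; lra|rewrite gtr_pMr//; lra].
  apply: cvg_near_cst; near=> n.
  rewrite /arc_bump/= !fctE/= max_r ?(ltW s0)// min_l//.
  rewrite -ler_pdivrMr// mul1r.
  near: n; exact: nbhs_infty_ger.
apply: cvg_near_cst; near=> n.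
rewrite /arc_bump/= !fctE/= max_l; first by rewrite mulr0 min_r.
rewrite -oppr_ge0 -mulrN -sinN mulr_ge0// sin_ge0_pi//.
  by apply/andP; split; [apply: mulr_ge0 => //; lra|rewrite ger_pMr//; lra].
rewrite -mulrN opprB.
by apply/andP; split; [apply: mulr_ge0 => //; lra|rewrite ger_pMr//; lra].
Unshelve. all: by end_near. Qed.

(** Inside [0, 1) a ray is everything, an arc (a, 1), or empty. *)
Lemma ray_approx (A : set R) : rays A -> exists f : nat -> R -> R,
  [/\ forall n, continuous (f n), forall n, periodic (f n) 1,
      forall n x, `|f n x| <= 1 &
      forall x, 0 <= x < 1 -> f n x @[n --> \oo] --> (\1_A x : R)].
Proof.
move=> rA.
have cstP (r : R) : `|r| <= 1 -> (forall x, 0 <= x < 1 -> (\1_A x : R) = r) ->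
    exists f : nat -> R -> R,
  [/\ forall n, continuous (f n), forall n, periodic (f n) 1,
      forall n x, `|f n x| <= 1 &
      forall x, 0 <= x < 1 -> f n x @[n --> \oo] --> (\1_A x : R)].
  move=> r1 Ar; exists (fun _ => cst r); split => //.
    by move=> n x; exact: cvg_cst.
  by move=> x /Ar ->; exact: cvg_cst.
case: rA => [AT|[a Aa]].
  by apply: (cstP 1); rewrite ?normr1// => x _; rewrite AT indicE in_setT.
have [a0|a0] := ltP a 0.
  apply: (cstP 1); rewrite ?normr1// => x /andP[x0 _].
  by rewrite Aa indicE mem_set//= in_itv/= (lt_le_trans a0).
have [a1|a1] := ltP a 1; last first.
  apply: (cstP 0); rewrite ?normr0 ?ler01// => x /andP[_ x1].
  rewrite Aa indicE memNset//= in_itv/= andbT; apply/negP.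
  by rewrite -leNgt (le_trans (ltW x1)).
exists (arc_bump a); split.
- exact: continuous_arc_bump.
- exact: periodic_arc_bump.
- exact: arc_bump_le1.
- by move=> x x01; rewrite Aa; apply: arc_bump_cvg => //; rewrite a0.
Qed.

End rays.

(** * Uniqueness of mixing measures with given marginal *)

Section uniqueness.
Context {R : realType}.
Local Notation mu := (@lebesgue_measure R).
Local Notation sq := (@square01 R).
Implicit Types (f g u v : R -> R) (nu : {charge set (plane R) -> \bar R}).

Lemma measurable_square01 : measurable sq.
Proof. by apply: measurableX; exact: measurable_itv. Qed.

Lemma continuous_bounded01 f : continuous f ->
  exists M, forall x, 0 <= x <= 1 -> `|f x| <= M.
Proof.
move=> cf.
have cfs : {within `[0, 1], continuous f} by exact: continuous_subspaceT.
have /compact_bounded[M [_ Mf]] := continuous_compact cfs (@segment_compact R 0 1).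
exists (M + 1) => x x01; apply: (Mf (M + 1)); first by rewrite ltrDl.
by exists x.
Qed.

Lemma measurable_tensor f g : continuous f -> continuous g ->
  measurable_fun setT (fun z : plane R => f z.1 * g z.2).
Proof.
move=> cf cg; apply: measurable_funM.
  apply: (@measurableT_comp _ _ _ _ _ _ f).
    exact: continuous_measurable_fun.
  exact: measurable_fst.
apply: (@measurableT_comp _ _ _ _ _ _ g).
  exact: continuous_measurable_fun.
exact: measurable_snd.
Qed.

Lemma bounded_measurable_tensor f g : continuous f -> continuous g ->
  bounded_measurable sq (fun z => f z.1 * g z.2).
Proof.
move=> cf cg; split; first by apply: measurable_funTS; exact: measurable_tensor.
have [M fM] := continuous_bounded01 cf; have [N gN] := continuous_bounded01 cg.
exists (M * N) => -[x y] [/=]; rewrite !in_itv/= => /andP[x0 x1] /andP[y0 y1].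
by rewrite normrM ler_pM// ?fM ?gN// ?x0 ?y0 ltW.
Qed.

(** By bounded convergence, equality on products of continuous periodic
    functions passes to indicators of products of rays. *)
Lemma eq_charge_of_tensors nu1 nu2 :
    carried_by_square nu1 -> carried_by_square nu2 ->
    (forall f g, continuous f -> periodic f 1 -> continuous g -> periodic g 1 ->
      charge_integral nu1 sq (fun z => f z.1 * g z.2) =
      charge_integral nu2 sq (fun z => f z.1 * g z.2)) ->
  forall A, measurable A -> nu1 A = nu2 A.
Proof.
move=> c1 c2 H.
apply: (@eq_charge _ _ _ _ _ quadrants measurable_quadrants quadrants_setI quadrantsT).
move=> _ [A rA [B rB <-]].
have mAB : measurable (A `*` B : set (plane R)).
  by apply: measurableX; rewrite measurable_rays; exact: sub_sigma_algebra.
have mAB' := measurableI _ _ mAB measurable_square01.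
rewrite c1// c2//.
suff : fine (nu1 (A `*` B `&` sq)) = fine (nu2 (A `*` B `&` sq)).
  move=> fE; rewrite -[LHS]fineK ?fE ?fineK//; exact: fin_num_measure.
rewrite -!charge_integral_indic//; [|exact: measurable_square01..].
have [f [cf pf bf fA]] := ray_approx rA.
have [g [cg pg bg gB]] := ray_approx rB.
have cvgI nu : charge_integral nu sq (fun z => f n z.1 * g n z.2) @[n --> \oo] -->
               charge_integral nu sq \1_(A `*` B).
  apply: (@charge_integral_cvg _ _ _ _ _ _ _ 1).
  - exact: measurable_square01.
  - by move=> n; apply: measurable_funTS; exact: measurable_tensor.
  - exact: measurable_indic.
  - by move=> n z _; rewrite normrM mulr_ile1.
  - move=> [x y] [/= ]; rewrite !in_itv/= => x01 y01.
    have -> : (\1_(A `*` B) (x, y) : R) = \1_A x * \1_B y.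
      by rewrite !indicE in_setX/=; case: (x \in A); case: (y \in B);
        rewrite ?mulr1 ?mulr0.
    by apply: cvgM; [exact: fA|exact: gB].
have := cvgI nu2.
under eq_fun do rewrite -H//.
by move/cvg_lim => <- //; apply/esym/cvg_lim => //; exact: cvgI.
Qed.

(** The increment of a primitive over one period is constant, with value the
    mean of f. *)
Lemma mean_zero_periodic_primitive f : continuous f -> periodic f 1 ->
    \int[mu]_(x in `[0, 1]) f x = 0 ->
  exists2 u, periodic_C1 u & derive1 u = f.
Proof.
move=> cf pf f0.
have [u du] := continuous_antiderivative cf.
have u'f : derive1 u = f by apply/funext => x; rewrite derive1E; have [] := du x.
exists u => //; split; last by rewrite u'f.
- pose s : R -> R := u \o (id + cst 1) - u.
  have ds (x : R) : is_derive x 1 s 0.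
    have dshift : is_derive x 1 (id + cst 1 : R -> R) 1.
      by apply: is_derive_eq; rewrite addr0.
    have dus : is_derive x 1 (u \o (id + cst 1)) (f (x + 1) * 1).
      by apply: is_derive1_comp; exact: du.
    by apply: is_derive_eq; rewrite mulr1 pf subrr.
  move=> x; have := is_derive_0_is_cst x 0 ds; rewrite /s /= !fctE /= add0r.
  have := f0; rewrite (Rintegral_antiderivative ler01 du cf) => -> /eqP.
  by rewrite subr_eq0 => /eqP.
- by move=> x; have [] := du x.
Qed.

Lemma eq_charge_integral_coordinate nu1 nu2 (phi : plane R -> measurableTypeR R) f :
    measurable_fun setT phi -> (forall z, sq z -> 0 <= phi z <= 1) ->
    continuous f ->
    (forall A : set R, measurable A ->
       nu1 (phi @^-1` A `&` sq) = nu2 (phi @^-1` A `&` sq)) ->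
  charge_integral nu1 sq (f \o phi) = charge_integral nu2 sq (f \o phi).
Proof.
move=> mphi phi01 cf H.
(* f may be unbounded on the line, hence the truncation to [0, 1]. *)
pose h : measurableTypeR R -> R := f \_ `[0, 1].
have hE : {in sq, f \o phi =1 h \o phi}.
  move=> z /[!inE] /phi01 z01; rewrite /h /= patchE mem_set//=.
rewrite (eq_charge_integral nu1 hE) (eq_charge_integral nu2 hE).
apply: eq_charge_integral_comp => //; first exact: measurable_square01.
split.
  apply/(measurable_restrictT _ _).1 => //.
  by apply: measurable_funTS; exact: continuous_measurable_fun.
have [M fM] := continuous_bounded01 cf.
have M0 : 0 <= M by apply: le_trans (fM 0 _); rewrite ?lexx ?ler01.
exists M => x _; rewrite /h patchE; case: ifPn => [|_]; last by rewrite normr0.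
by rewrite inE/= in_itv/=; exact: fM.
Qed.

(** Writing f0 and g0 for f and g minus their means a and b,
    f(x) g(y) = f0(x) g0(y) + b f0(x) + a g(y).  The first term is of the form
    u'(x) v'(y), the other two depend on one coordinate each. *)
Lemma mixing_measure_unique (m : probability (measurableTypeR R) R) nu1 nu2 :
    mixing_measure m nu1 -> mixing_measure m nu2 ->
    (forall A : set (measurableTypeR R), measurable A ->
      marginal nu1 A = marginal nu2 A) ->
  forall A, measurable A -> nu1 A = nu2 A.
Proof.
move=> [c1 s1 M1] [c2 s2 M2] M12.
have fstE nu A : carried_by_square nu -> measurable A ->
    nu (fst @^-1` A `&` sq) = marginal nu A.
  move=> cnu mA; rewrite /marginal [RHS]cnu; last exact: measurableX.
  congr (nu _); apply/seteqP; split => -[x y] /= [Ax [x01 y01]];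
    by do !split => //; case: Ax.
have sndE nu A : carried_by_square nu -> symmetric_charge nu -> measurable A ->
    nu (snd @^-1` A `&` sq) = marginal nu A.
  move=> cnu snu mA; rewrite -fstE// -[RHS]snu.
    by congr (nu _); apply/seteqP; split => -[x y] /= [Ax [x01 y01]].
  apply: measurableI; last exact: measurable_square01.
  by rewrite -[X in measurable X]setTI; exact: measurable_fst.
have fst12 f : continuous f -> charge_integral nu1 sq (fun z => f z.1) =
    charge_integral nu2 sq (fun z => f z.1).
  move=> cf; apply: (eq_charge_integral_coordinate measurable_fst _ cf).
    by move=> [x y] [/=]; rewrite !in_itv/= => /andP[-> /ltW].
  by move=> A mA; rewrite !fstE// M12.
have snd12 f : continuous f -> charge_integral nu1 sq (fun z => f z.2) =
    charge_integral nu2 sq (fun z => f z.2).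
  move=> cf; apply: (eq_charge_integral_coordinate measurable_snd _ cf).
    by move=> [x y] [/= _]; rewrite !in_itv/= => /andP[-> /ltW].
  by move=> A mA; rewrite !sndE// M12.
apply: eq_charge_of_tensors => // f g cf pf cg pg.
pose mean (h : R -> R) := \int[mu]_(x in `[0, 1]) h x.
pose center h (x : R) : R := h x - mean h.
have ccenter (h : R -> R) : continuous h -> continuous (center h).
  by move=> ch x; apply: cvgB; [exact: ch|exact: cvg_cst].
have primitive (h : R -> R) : continuous h -> periodic h 1 ->
    exists2 u, periodic_C1 u & derive1 u = center h.
  move=> ch ph; apply: mean_zero_periodic_primitive.
  - exact: ccenter.
  - by move=> x; rewrite /center ph.
  - rewrite RintegralB//; [|exact: continuous_integrable_segment|
      by apply: continuous_integrable_segment => x; exact: cvg_cst].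
    by rewrite Rintegral_cst//= lebesgue_measure_itv/= lte01 -EFinB subr0 mulr1 subrr.
have [u pu u'] := primitive f cf pf.
have [v pv v'] := primitive g cg pg.
have tensorE nu : charge_integral nu sq (fun z => f z.1 * g z.2) =
    charge_integral nu sq (fun z => derive1 u z.1 * derive1 v z.2) +
    (mean g * charge_integral nu sq (fun z => center f z.1) +
     mean f * charge_integral nu sq (fun z => g z.2)).
  have msq := measurable_square01.
  have one : continuous (cst 1 : R -> R) by move=> x; exact: cvg_cst.
  have b1 (h : R -> R) : continuous h -> bounded_measurable sq (fun z => h z.1).
    move=> ch; have := bounded_measurable_tensor ch one.
    by under eq_fun do rewrite mulr1.
  have b2 (h : R -> R) : continuous h -> bounded_measurable sq (fun z => h z.2).
    move=> ch; have := bounded_measurable_tensor one ch.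
    by under eq_fun do rewrite mul1r.
  have bZ (r : R) (h : plane R -> R) : bounded_measurable sq h ->
      bounded_measurable sq (fun z => r * h z).
    move=> [mh [M hM]]; split.
      by apply: measurable_funM => //; exact: measurable_cst.
    by exists (`|r| * M) => z /hM; rewrite normrM => ?; exact: ler_wpM2l.
  have bD (h k : plane R -> R) : bounded_measurable sq h -> bounded_measurable sq k ->
      bounded_measurable sq (fun z => h z + k z).
    move=> [mh [M hM]] [mk [N kN]]; split; first exact: measurable_funD.
    exists (M + N) => z sz; apply: le_trans (ler_normD _ _) _.
    by rewrite lerD ?hM ?kN.
  have bf := bZ (mean g) _ (b1 _ (ccenter f cf)).
  have bg := bZ (mean f) _ (b2 _ cg).
  rewrite u' v' -(charge_integralZl nu (mean g) msq (b1 _ (ccenter f cf))).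
  rewrite -(charge_integralZl nu (mean f) msq (b2 _ cg)).
  rewrite -(charge_integralD nu msq bf bg).
  rewrite -(charge_integralD nu msq
    (bounded_measurable_tensor (ccenter f cf) (ccenter g cg)) (bD _ _ bf bg)).
  by apply: eq_charge_integral => z _; rewrite /center; ring.
rewrite !tensorE -M1// -M2//; congr (_ + (_ * _ + _ * _)).
  by apply: fst12; exact: ccenter.
exact: snd12.
Qed.

End uniqueness.

(** * The signed measure with the mixing density *)

Section existence.
Context {R : realType}.
Local Notation mu := (@lebesgue_measure R).
Local Notation leb2 := (mu \x mu)%E.
Local Notation sq := (@square01 R).
Local Notation osq := (@open_square01 R).
Implicit Types (f g u v : R -> R) (c : R).

Lemma measurable_open_square01 : measurable osq.
Proof. by apply: measurableX; exact: measurable_itv. Qed.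

Lemma sigma_finite_leb2 : sigma_finite (setT : set (plane R)) leb2.
Proof.
pose I n : set (measurableTypeR R) := `[- n%:R, n%:R]%classic.
have mI n : measurable (I n) by exact: measurable_itv.
exists (fun n => I n `*` I n) => [|n].
  apply/esym; rewrite -subTset => -[x y] _.
  have [n xyn] : exists n, Num.max `|x| `|y| <= n%:R.
    by exists (Num.truncn (Num.max `|x| `|y|)).+1; rewrite ltW// truncnS_gt.
  exists n => //; move: xyn; rewrite ge_max !ler_norml => /andP[xn yn].
  by split; rewrite /I /= in_itv.
split; first exact: measurableX.
rewrite product_measure1E//= lebesgue_measure_itv/=.
by case: ifPn => _; rewrite -?EFinB -?EFinM ?mule0 ltry.
Qed.

Lemma leb2_open_square01_lty : (leb2 osq < +oo)%E.
Proof.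
rewrite product_measure1E; [|exact: measurable_itv..].
by rewrite /= lebesgue_measure_itv/= lte01 -EFinB subr0 mul1e ltry.
Qed.

(** Fubini for the strips A x (0, 1) of the open square.  The inner integral is
    taken over the closed interval, the form in which the fundamental theorem
    of calculus computes it. *)
Lemma integral_strip_open_square01 (h : plane R -> R) (A : set R) :
    bounded_measurable osq h -> (forall x, continuous (fun y => h (x, y))) ->
    measurable A ->
  let H x := \int[mu]_(y in `[0, 1]) h (x, y) in
  mu.-integrable `]0, 1[ (EFin \o H) /\
  (\int[leb2]_(z in (A `*` setT) `&` osq) (h z)%:E =
   \int[mu]_(x in A `&` `]0%R, 1%R[) (H x)%:E)%E.
Proof.
move=> bh ch mA H.
have mosq := measurable_open_square01.
have mAT : measurable (A `*` setT : set (plane R)) by exact: measurableX.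
have inth : leb2.-integrable osq (EFin \o h).
  by apply: bounded_measurable_integrable => //; exact: leb2_open_square01_lty.
pose hA (B : set R) := (EFin \o h) \_ ((B `*` setT) `&` osq).
have inthA B : measurable B -> leb2.-integrable setT (hA B).
  move=> mB; have mBT : measurable (B `*` setT : set (plane R)) by exact: measurableX.
  rewrite /hA -(integrable_mkcond _ (measurableI _ _ mBT mosq)).
  by apply: integrableS inth => //; exact: measurableI.
have FE B : fubini_F mu (hA B) = (EFin \o H) \_ (B `&` `]0, 1[).
  apply/funext => x; rewrite /fubini_F patchE; case: ifPn => [|xB].
    rewrite inE /= => -[Bx x01].
    transitivity (\int[mu]_(y in `]0%R, 1%R[) (h (x, y))%:E)%E.
      rewrite [RHS]integral_mkcond; apply: eq_integral => y _.
      rewrite /hA !patchE; congr (if _ then _ else _).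
      apply/idP/idP; rewrite !inE; first by move=> [_ []].
      by move=> y01; split.
    rewrite /H -Rintegral_itv_obnd_cbnd; last first.
      apply: integrableS (continuous_integrable_segment 0 1 (ch x)) => //.
      exact: subset_itv_oc_cc.
    rewrite -Rintegral_itv_bndo_bndc; last first.
      apply: integrableS (continuous_integrable_segment 0 1 (ch x)) => //.
      exact: subset_itv_oo_cc.
    rewrite fineK//; apply: integrable_fin_num => //.
    apply: integrableS (continuous_integrable_segment 0 1 (ch x)) => //.
    exact: subset_itv_oo_cc.
  rewrite integral0_eq// => y _; rewrite /hA patchE memNset//= => -[[Bx _] [x01 _]].
  by move/negP: xB; apply; rewrite inE.
split.
  have : mu.-integrable setT (fubini_F mu (hA setT)).
    exact: integrable_fubini_F (inthA setT measurableT).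
  by rewrite FE setTI -integrable_mkcond.
rewrite integral_mkcond -/(hA A).
transitivity (\int[mu]_x fubini_F mu (hA A) x)%E.
  exact/esym/(integral12_prod_meas1 (inthA _ mA)).
rewrite FE.
by rewrite -integral_mkcond.
Qed.

Lemma measurable_mixing_kernel c :
  measurable_fun setT (fun z : plane R => mixing_kernel c z.1 z.2).
Proof.
have mn : measurable_fun setT (fun z : plane R => `|z.1 - z.2|).
  apply: (@measurableT_comp _ _ _ _ _ _ (@Num.norm R R)) => //.
  by apply: measurable_funB; [exact: measurable_fst|exact: measurable_snd].
apply: measurable_funD; last exact: measurable_cst.
apply: measurable_funM; first exact: measurable_cst.
apply: measurable_funB; first exact: measurable_cst.
apply: measurable_funM; first by apply: measurable_funM => //; exact: measurable_cst.
by apply: measurable_funB => //; exact: measurable_cst.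
Qed.

Lemma mixing_kernel_bound c x y : 0 <= x <= 1 -> 0 <= y <= 1 ->
  `|mixing_kernel c x y| <= 1 + `|c - 24^-1|.
Proof.
move=> /andP[x0 x1] /andP[y0 y1]; rewrite /mixing_kernel.
apply: le_trans (ler_normD _ _) _; rewrite lerD2r.
set h := `|x - y|.
have h0 : 0 <= h by exact: normr_ge0.
have h1 : h <= 1 by rewrite /h ler_norml; apply/andP; split; lra.
by rewrite /Dfun ler_norml; apply/andP; split; nra.
Qed.

Lemma bounded_measurable_mixing_kernel c D : measurable D -> D `<=` sq ->
  bounded_measurable D (fun z => mixing_kernel c z.1 z.2).
Proof.
move=> mD Dsq; split; first by apply: measurable_funTS; exact: measurable_mixing_kernel.
exists (1 + `|c - 24^-1|) => -[x y] /Dsq[/=]; rewrite !in_itv/=.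
by move=> /andP[x0 x1] /andP[y0 y1]; apply: mixing_kernel_bound; rewrite ?x0 ?y0 ltW.
Qed.

Lemma open_square01_sub : osq `<=` sq.
Proof.
move=> [x y] [/=]; rewrite !in_itv/= => /andP[x0 x1] /andP[y0 y1].
by split; rewrite /= in_itv/= ?x1 ?y1 andbT ltW.
Qed.

Definition mixing_density c : plane R -> \bar R :=
  (fun z => (mixing_kernel c z.1 z.2)%:E) \_ osq.

Lemma integrable_mixing_kernel c :
  leb2.-integrable osq (EFin \o (fun z => mixing_kernel c z.1 z.2)).
Proof.
apply: bounded_measurable_integrable.
- exact: measurable_open_square01.
- exact: leb2_open_square01_lty.
- apply: bounded_measurable_mixing_kernel open_square01_sub.
  exact: measurable_open_square01.
Qed.

Lemma integrable_mixing_density c : leb2.-integrable setT (mixing_density c).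
Proof.
rewrite /mixing_density -integrable_mkcond; first exact: integrable_mixing_kernel.
exact: measurable_open_square01.
Qed.

Definition mixing_charge c : {charge set (plane R) -> \bar R} :=
  induced_charge (integrable_mixing_density c).

Lemma mixing_chargeE c A :
  (mixing_charge c A = \int[leb2]_(z in A `&` osq) (mixing_kernel c z.1 z.2)%:E)%E.
Proof. by rewrite /= /induced_charge/= /mixing_density integral_mkcondr. Qed.

Lemma charge_integral_mixing_charge c (g : plane R -> R) : bounded_measurable sq g ->
  charge_integral (mixing_charge c) sq g =
  fine (\int[leb2]_(z in osq) (g z * mixing_kernel c z.1 z.2)%:E)%E.
Proof.
move=> bg.
transitivity (fine (\int[leb2]_(z in sq) ((g z)%:E * mixing_density c z))%E).
  (* The Radon-Nikodym theorem takes the product measure as a sigma-finite one. *)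
  pose sigma_leb2 : {sigma_finite_measure set (plane R) -> \bar R} :=
    HB.pack (leb2 : set (plane R) -> \bar R) (Measure.on leb2)
      (Measure_isSigmaFinite.Build _ _ _ leb2 sigma_finite_leb2).
  exact: (@charge_integral_induced _ _ _ sigma_leb2 _ (integrable_mixing_density c)
    sq g measurable_square01 bg).
congr fine; rewrite [LHS]integral_mkcond [RHS]integral_mkcond.
apply: eq_integral => z _.
rewrite /mixing_density !patchE.
have [zo|zo] := boolP (z \in osq); last first.
  by rewrite -[point]/(0%E : \bar R) mule0 if_same.
by rewrite ifT//; move: zo; rewrite !inE; exact: open_square01_sub.
Qed.

Lemma mixing_charge_carried c : carried_by_square (mixing_charge c).
Proof.
move=> A mA; rewrite !mixing_chargeE -setIA (setIidr (open_square01_sub)) //.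
Qed.

(** The density is symmetric, and the product of Lebesgue measure with itself can
    be integrated in either order: one order for A, the other for its mirror
    image. *)
Lemma mixing_charge_symmetric c : symmetric_charge (mixing_charge c).
Proof.
move=> A mA; rewrite !mixing_chargeE.
set B := [set z | A (z.2, z.1)].
have mB : measurable B.
  rewrite -[B]setTI; apply: (measurable_fun_pair measurable_snd measurable_fst) => //.
pose k C := (fun z : plane R => (mixing_kernel c z.1 z.2)%:E) \_ (C `&` osq).
have ik C : measurable C -> leb2.-integrable setT (k C).
  move=> mC; have mCo := measurableI _ _ mC measurable_open_square01.
  rewrite /k -integrable_mkcond//.
  apply: integrableS (integrable_mixing_kernel c) => //.
  exact: measurable_open_square01.
rewrite integral_mkcond [RHS]integral_mkcond -/(k A) -/(k B).
transitivity (\int[mu]_x fubini_F mu (k B) x)%E.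
  exact/esym/(integral12_prod_meas1 (ik _ mB)).
transitivity (\int[mu]_x fubini_G mu (k A) x)%E; last first.
  exact: integral21_prod_meas1 (ik _ mA).
apply: eq_integral => x _; apply: eq_integral => y _.
rewrite /k !patchE /mixing_kernel/= distrC; congr (if _ then _ else _).
by apply/idP/idP; rewrite !inE => -[? []].
Qed.

(** Endpoints are null, so each of the four intervals can be used: [0, 1) in
    [cov01] and (0, 1) in the density. *)
Lemma uniform01_itvE (b0 b1 : bool) (A : set (measurableTypeR R)) : measurable A ->
  uniform01 R A = mu (A `&` [set` Interval (BSide b0 0) (BSide b1 1)]).
Proof.
move=> mA.
transitivity (\int[mu]_(x in A `&` `[0%R, 1%R]) (cst 1 x))%E.
  rewrite /uniform01 /= /uniform_prob integral_uniform_pdf.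
  apply: eq_integral => x /[!inE] -[_ /=]; rewrite in_itv/= => x01.
  by rewrite /uniform_pdf x01 subr0 invr1.
have m1 : measurable_fun (`]0, 1[%classic : set (measurableTypeR R))
    ((cst 1%E : R -> \bar R) \_ A).
  by apply/measurable_restrict => //; exact: measurable_cst.
rewrite integral_mkcondl integral_itv_bndoo// -(@integral_itv_bndoo _ _ _ _ b0 b1)//.
rewrite -integral_mkcondl integral_cst ?mul1e//.
by apply: measurableI => //; exact: measurable_itv.
Qed.

Lemma mixing_charge_marginal c (A : set (measurableTypeR R)) : measurable A ->
  (marginal (mixing_charge c) A = c%:E * uniform01 R A)%E.
Proof.
move=> mA; rewrite /marginal mixing_chargeE.
have -> : A `*` `[0, 1[%classic `&` osq = (A `*` setT) `&` osq.
  apply/seteqP; split => -[x y] /=; first by move=> [[Ax _] [x01 y01]].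
  move=> [[Ax _] [x01 y01]]; split => //; split => //.
  by move: y01; rewrite /= !in_itv/= => /andP[/ltW-> ->].
have [_ ->] := @integral_strip_open_square01 (fun z => mixing_kernel c z.1 z.2) A
  (bounded_measurable_mixing_kernel c measurable_open_square01 open_square01_sub)
  (@continuous_mixing_kernel R c) mA.
rewrite (uniform01_itvE false true mA) -integral_cst; last first.
  by apply: measurableI => //; exact: measurable_itv.
apply: eq_integral => x /[!inE] -[_ /=]; rewrite in_itv/= => /andP[x0 x1].
by rewrite Rintegral_mixing_kernel1// !ltW.
Qed.

Lemma cov01_uniform01 u v : continuous u -> continuous v ->
  cov01 (uniform01 R) u v = \int[mu]_(x in `[0, 1]) (u x * v x) -
  \int[mu]_(x in `[0, 1]) u x * \int[mu]_(x in `[0, 1]) v x.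
Proof.
move=> cu cv.
have unifE f : continuous f ->
    \int[uniform01 R]_(x in `[0, 1[) f x = \int[mu]_(x in `[0, 1]) f x.
  move=> cf; rewrite -Rintegral_itv_bndo_bndc; last first.
    apply: integrableS (continuous_integrable_segment 0 1 cf) => //.
    exact: subset_itv_co_cc.
  congr fine; apply: eq_measure_integral => A mA A01.
  by have := uniform01_itvE true true mA; rewrite setIidl// => <-.
rewrite /cov01 !unifE//.
by move=> x; apply: cvgM; [exact: cu|exact: cv].
Qed.

Lemma mixing_charge_mixing c : mixing_measure (uniform01 R) (mixing_charge c).
Proof.
split; [exact: mixing_charge_carried|exact: mixing_charge_symmetric|].
move=> u v [pu du cu'] [pv dv cv'].
have Du (x : R) : is_derive x 1 u (derive1 u x) by rewrite derive1E; exact: DeriveDef.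
have Dv (x : R) : is_derive x 1 v (derive1 v x) by rewrite derive1E; exact: DeriveDef.
rewrite (cov01_uniform01 (is_derive1_continuous Du) (is_derive1_continuous Dv)).
rewrite -(double_integral_mixing_kernel c cu' cv' Du Dv); last 2 first.
- by have := pu 0; rewrite add0r.
- by have := pv 0; rewrite add0r.
rewrite charge_integral_mixing_charge; last exact: bounded_measurable_tensor.
set f := derive1 u; set g := derive1 v.
pose h (z : plane R) := f z.1 * g z.2 * mixing_kernel c z.1 z.2.
have bh : bounded_measurable osq h.
  have [mt [M tM]] := bounded_measurable_tensor cu' cv'.
  have [mk [N kN]] := bounded_measurable_mixing_kernel c measurable_open_square01
    open_square01_sub.
  split; first by apply: measurable_funM => //; apply: measurable_funS mt => //;
    [exact: measurable_square01|exact: open_square01_sub].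
  exists (M * N) => z oz; rewrite normrM ler_pM// ?kN//.
  by apply: tM; exact: open_square01_sub.
have ch x : continuous (fun y => h (x, y)).
  suff : continuous (fun y => f x * g y * mixing_kernel c x y) by [].
  move=> y; apply: cvgM; last exact: continuous_mixing_kernel.
  by apply: cvgM; [exact: cvg_cst|exact: cv'].
have [/= iH HE] := integral_strip_open_square01 bh ch measurableT.
rewrite setXTT setTI in HE.
transitivity (\int[mu]_(x in `]0, 1[) \int[mu]_(y in `[0, 1]) h (x, y)); last first.
  by rewrite HE setTI.
congr fine; apply: integral_itv_bndoo; exact: measurable_int iH.
Qed.

End existence.

(** * Existence, uniqueness and density *)

Theorem corollary6p1 (R : realType) (c : R) :
  exists lam : {charge set (plane R) -> \bar R},
    [/\ mixing_measure (uniform01 R) lam,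
        (forall A : set (measurableTypeR R), measurable A ->
          marginal lam A = (c%:E * uniform01 R A)%E),
        (forall lam' : {charge set (plane R) -> \bar R},
          mixing_measure (uniform01 R) lam' ->
          (forall A : set (measurableTypeR R), measurable A ->
            marginal lam' A = (c%:E * uniform01 R A)%E) ->
          forall A : set (plane R),
            measurable A -> lam' A = lam A)
      & has_density lam
          (fun z : plane R =>
             Dfun `|z.1 - z.2| + (c - 24^-1))].
Proof.
exists (mixing_charge c); split.
- exact: mixing_charge_mixing.
- exact: mixing_charge_marginal.
- move=> lam' mixing' marginal' A mA.
  apply: (mixing_measure_unique mixing' (mixing_charge_mixing c)) => // B mB.
  by rewrite marginal'// mixing_charge_marginal.
- by split; [exact: integrable_mixing_kernel|move=> A mA; exact: mixing_chargeE].
Qed.
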